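(* Let $b(n,m)$ denote the number of Arndt compositions of $n$ whose last part equals $m$. Define $t_1(0)=1$, $t_1(1)=0$, $t_1(n)=F_{n-2}$ for $n\ge2$, and $t_2(0)=0$, $t_2(1)=1$, $t_2(n)=F_{n-1}$ for $n\ge 2$, where $F_n$ are the Fibonacci numbers ($F_0=0,F_1=1,F_n=F_{n-1}+F_{n-2}$). Then for all integers $n\ge 1$ and $m\ge 1$, $$b(n,m)=\begin{cases} t_1(n-m), & \text{if } m\leq n <2m,\\ t_1(n-m) + t_2(n-2m), & \text{if } 2m\leq n,\\ 0, & \text{otherwise.} \end{cases}$$
   Context: A composition of $n$ is a finite sequence $(\sigma_1,\dots,\sigma_\ell)$ of positive integers summing to $n$. An Arndt composition is one with $\sigma_{2i-1}>\sigma_{2i}$ for every positive integer $i$ with $2i\le\ell$. The last part of a nonempty composition is $\sigma_\ell$. *)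

(* Defs.v *)
From mathcomp Require Import all_boot.

Set Implicit Arguments.
Unset Strict Implicit.
Unset Printing Implicit Defensive.

Definition is_composition (n : nat) (s : seq nat) : bool :=
  all (fun x => 0 < x) s && (sumn s == n).

(* sigma_i with the usual 1-based indexing; only meaningful for 1 <= i <= size s *)
Definition part (s : seq nat) (i : nat) : nat := nth 0 s i.-1.

Definition is_arndt (s : seq nat) : bool :=
  [forall i : 'I_(size s).+1,
    (0 < i) && (2 * i <= size s) ==> (part s (2 * i - 1) > part s (2 * i))].

(* [last 0 s] is 0 on the empty sequence, so for 0 < m the empty composition
   is never counted *)
Definition is_arndt_last (n m : nat) (s : seq nat) : bool :=
  [&& is_composition n s, is_arndt s & last 0 s == m].

(* Every composition of n has at most n parts, each at most n, so it is
   represented exactly once in the finite type n.-bseq 'I_n.+1: see b_enum *)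
Definition b (n m : nat) : nat :=
  #|[set s : n.-bseq 'I_n.+1 | is_arndt_last n m (map val s)]|.

Fixpoint fib (n : nat) : nat :=
  match n with
  | 0 => 0
  | 1 => 1
  | (n''.+1 as n').+1 => fib n' + fib n''
  end.

Definition t1 (n : nat) : nat :=
  match n with 0 => 1 | 1 => 0 | _ => fib (n - 2) end.

Definition t2 (n : nat) : nat :=
  match n with 0 => 0 | 1 => 1 | _ => fib (n - 1) end.

Lemma is_arndtP (s : seq nat) :
  reflect (forall i, 0 < i -> 2 * i <= size s -> part s (2 * i - 1) > part s (2 * i))
          (is_arndt s).
Proof.
apply: (iffP forallP) => [H i i0 is_ | H i].
  have lt_i : i < (size s).+1.
    by rewrite ltnS (leq_trans _ is_)// mul2n -addnn leq_addr.
  by have /implyP := H (Ordinal lt_i); apply; rewrite /= i0.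
by apply/implyP => /andP[]; apply: H.
Qed.

Lemma composition_bound n s :
  is_composition n s -> (size s <= n) && all (fun x => x < n.+1) s.
Proof.
case/andP=> + /eqP <-; elim: s => //= x s IH /andP[x0 /IH /andP[ss sl]].
rewrite ltnS leq_addr -[(size s).+1]add1n leq_add //=.
by apply: sub_all sl => y; rewrite !ltnS => /leq_trans; apply; apply: leq_addl.
Qed.

Lemma b_enum n m (l : seq (seq nat)) :
  uniq l -> (forall s, (s \in l) = is_arndt_last n m s) -> b n m = size l.
Proof.
move=> ul lE; rewrite /b cardE.
set e := enum _; pose f (s : n.-bseq 'I_n.+1) := map val s.
have fI : injective f by move=> x y /(inj_map val_inj) /val_inj.
rewrite -(size_map f); apply/perm_size/uniq_perm => //.
  by rewrite map_inj_uniq ?enum_uniq.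
move=> s; rewrite lE; apply/mapP/idP => [[x + ->]|Ps].
  by rewrite mem_enum inE.
have /andP[ss sl] : (size s <= n) && all (fun x => x < n.+1) s.
  by apply: composition_bound; case/and3P: Ps.
have ps : size (map (@inord n) s) <= n by rewrite size_map.
have Es : s = f (Bseq ps).
  rewrite /f /= -map_comp -[LHS]map_id; apply/eq_in_map => x xs /=.
  by rewrite inordK //; apply: (allP sl).
by exists (Bseq ps) => //; rewrite mem_enum inE -/(f _) -Es.
Qed.

(* Main.v *)
(** Write an Arndt composition with last part [m] as pairs (a_1, b_1),
    (a_2, b_2), ..., followed in odd length by the single part [m], and encode
    it by the word 1^(a_1 - b_1) 2^(b_1) 1^(a_2 - b_2) 2^(b_2) ... without the
    last part: the final pair (a, m) of an even-length composition contributes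
    only 1^(a - m).  This is a bijection onto the words in 1 and 2 that do not
    start with 2.  Odd lengths give the words that are empty or end with 2, of
    letter sum [n - m]; even lengths give the words that end with 1, of letter
    sum [n - 2m].  Among all words of sum [k + 1], F_k end with 2 and F_(k+1)
    end with 1; removing the initial 1 turns these counts into [t1] and [t2]. *)
Require Import Defs.
From mathcomp Require Import all_boot zify.

Set Implicit Arguments.
Unset Strict Implicit.
Unset Printing Implicit Defensive.

Lemma is_arndt_nthP (s : seq nat) :
  reflect (forall i, i.*2.+1 < size s -> nth 0 s i.*2.+1 < nth 0 s i.*2)
          (is_arndt s).
Proof.
have partE i : (part s (2 * i.+1 - 1) = nth 0 s i.*2) *
               (part s (2 * i.+1) = nth 0 s i.*2.+1).
  by split; congr nth; lia.
apply: (iffP (is_arndtP s)) => [arndt_s i lt_is | arndt_s [//|i] _ le_is].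
  by rewrite -!partE; apply: arndt_s; lia.
by rewrite !partE; apply: arndt_s; lia.
Qed.

Lemma is_arndt_short (s : seq nat) : size s <= 1 -> is_arndt s.
Proof. by move=> s_short; apply/is_arndt_nthP => i; lia. Qed.

Lemma is_arndt_cons2 (a b : nat) (s : seq nat) :
  is_arndt [:: a, b & s] = (b < a) && is_arndt s.
Proof.
apply/is_arndt_nthP/andP => [arndt_abs | [lt_ba /is_arndt_nthP arndt_s]].
  split; first exact: (arndt_abs 0).
  by apply/is_arndt_nthP => i; apply: (arndt_abs i.+1).
by case=> [//|i]; apply: arndt_s.
Qed.

(* The letters 1 and 2 are [false] and [true]. *)
Definition weight (w : bitseq) : nat := sumn [seq x.+1 | x : bool <- w].

Fixpoint words (k : nat) : seq bitseq :=
  match k with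
  | 0 => [:: [::]]
  | 1 => [:: [:: false]]
  | (k2.+1 as k1).+1 =>
      map (cons false) (words k1) ++ map (cons true) (words k2)
  end.

Lemma wordsSS (k : nat) :
  words k.+2 = map (cons false) (words k.+1) ++ map (cons true) (words k).
Proof. by []. Qed.

Lemma mem_map_cons (T : eqType) (x y : T) (s : seq T) (l : seq (seq T)) :
  (x :: s \in map (cons y) l) = (x == y) && (s \in l).
Proof.
apply/mapP/andP => [[t t_l [-> ->]]|[/eqP -> s_l]]; last by exists s.
by rewrite eqxx.
Qed.

Lemma mem_words (k : nat) (w : bitseq) : (w \in words k) = (weight w == k).
Proof.
elim: w k => [|x w IH] [|[|k]] //.
- by rewrite wordsSS mem_cat; apply/norP; split; apply/mapP => -[].
- have := IH 0; rewrite !inE eqseq_cons /weight /= => ->.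
  by case: x; lia.
rewrite wordsSS mem_cat !mem_map_cons !IH.
by case: x; rewrite /weight /=; lia.
Qed.

Lemma uniq_words (k : nat) : uniq (words k).
Proof.
have cons_inj x : injective (cons x : bitseq -> bitseq) by move=> w1 w2 [].
elim/ltn_ind: k => -[|[|k]] // IH.
rewrite wordsSS cat_uniq !map_inj_uniq ?IH //= andbT.
by apply/hasPn => _ /mapP[w _ ->]; rewrite mem_map_cons.
Qed.

Lemma size_words (k : nat) : size (words k) = fib k.+1.
Proof.
elim/ltn_ind: k => -[|[|k]] // IH.
by rewrite wordsSS size_cat !size_map !IH.
Qed.

Lemma count_words_last (x : bool) (k : nat) :
  count (last x) (words k.+1) = fib k.
Proof.
elim/ltn_ind: k x => -[|[|k]] // IH x.
by rewrite wordsSS count_cat !count_map !IH.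
Qed.

Lemma count_words_head_false (a : pred bitseq) (k : nat) :
  count [pred w | ~~ head false w & a w] (words k.+1) =
  count (fun w => a (false :: w)) (words k).
Proof.
case: k => [//|k]; rewrite wordsSS count_cat !count_map /=.
by rewrite [X in _ + X](@eq_count _ _ pred0) ?count_pred0 ?addn0 // => w.
Qed.

Lemma count_words_t1 (k : nat) :
  count [pred w | ~~ head false w & last true w] (words k) = t1 k.
Proof.
case: k => [//|k]; rewrite count_words_head_false /=.
by case: k => [//|k]; rewrite count_words_last /t1 subn2.
Qed.

Lemma count_words_t2 (k : nat) :
  count [pred w | ~~ head false w & ~~ last true w] (words k) = t2 k.
Proof.
case: k => [//|k]; rewrite (count_words_head_false (predC (last true))) /=.
case: k => [//|k]; apply: (@addnI (fib k)).
rewrite -{1}(count_words_last false) count_predC size_words.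
by rewrite /t2 subn1 addnC.
Qed.

Fixpoint word_of_arndt (s : seq nat) : bitseq :=
  if s is [:: a, b & t] then
    nseq (a - b) false ++
    (if t is [::] then [::] else nseq b true ++ word_of_arndt t)
  else [::].

(* A first pair with equal parts encodes a word that starts with 2; a final pair
   records no 2, hence [t != [::]]. *)
Definition starts_tied (s : seq nat) : bool :=
  if s is [:: a, b & t] then (t != [::]) && (a == b) else false.

Definition near_arndt (s : seq nat) : bool :=
  is_arndt s || starts_tied s && is_arndt (drop 2 s).

Lemma near_arndt_cons2 (a b : nat) (s : seq nat) :
  near_arndt [:: a, b & s] =
  is_arndt s && ((b < a) || (s != [::]) && (a == b)).
Proof. by rewrite /near_arndt is_arndt_cons2 /= drop0 -andb_orl andbC. Qed.

Lemma is_arndt_near (s : seq nat) :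
  is_arndt s = near_arndt s && ~~ starts_tied s.
Proof.
case: s => [|a [|b s]]; rewrite ?near_arndt_cons2 /near_arndt ?andbT ?orbF //=.
by rewrite is_arndt_cons2; case: is_arndt; lia.
Qed.

Definition push_one (s : seq nat) : seq nat :=
  match s with
  | [::] => [::]
  | [:: a] => [:: a.+1; a]
  | a :: t => a.+1 :: t
  end.

Definition push_two (s : seq nat) : seq nat :=
  if starts_tied s then map succn (take 2 s) ++ drop 2 s else [:: 1, 1 & s].

Definition push (x : bool) : seq nat -> seq nat :=
  if x then push_two else push_one.

Lemma push_two_cons2 (a b : nat) (s : seq nat) :
  push_two [:: a, b & s] =
  if (s != [::]) && (a == b) then [:: a.+1, b.+1 & s] else [:: 1, 1, a, b & s].
Proof. by rewrite /push_two /= take0 drop0. Qed.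

Section Push.

Variables (x : bool) (s : seq nat).
Hypothesis s_neq0 : s != [::].

Lemma size_push_gt1 : 1 < size (push x s).
Proof.
case: s s_neq0 => [|a [|b t]] //; case: x => //= _.
by rewrite push_two_cons2; case: ifP.
Qed.

Lemma last_push : last 0 (push x s) = last 0 s.
Proof.
case: s s_neq0 => [|a [|b t]] //; case: x => //= _.
by rewrite push_two_cons2; case: t => [|c t] //=; case: ifP.
Qed.

Lemma word_of_arndt_push :
  near_arndt s -> word_of_arndt (push x s) = x :: word_of_arndt s.
Proof.
case: s s_neq0 => [|a [|b t]] //; case: x => _ /=; rewrite ?subSnn //;
  rewrite near_arndt_cons2.
  rewrite push_two_cons2 => _; case: ifP => [/andP[t_neq0 /eqP ->]|//] /=.
  by rewrite !subnn; case: t t_neq0.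
by move=> near_abt; rewrite subSn //; lia.
Qed.

Lemma starts_tied_push : near_arndt s -> starts_tied (push x s) = x.
Proof.
case: s s_neq0 => [|a [|b t]] //; case: x => //= _; rewrite near_arndt_cons2.
  by rewrite push_two_cons2; case: ifP.
by move=> near_abt; apply/negbTE; lia.
Qed.

Lemma near_arndt_push : near_arndt s -> near_arndt (push x s).
Proof.
case: s s_neq0 => [|a [|b t]] //; case: x => /= _; rewrite ?near_arndt_cons2.
- by rewrite is_arndt_short.
- by rewrite is_arndt_short ?ltnSn.
- rewrite push_two_cons2 => near_abt.
  by case: ifP => tie; rewrite near_arndt_cons2 /= ?is_arndt_cons2 //; lia.
- by lia.
Qed.

End Push.

Lemma all_gt0_push (x : bool) (s : seq nat) :
  all (fun a => 0 < a) s -> all (fun a => 0 < a) (push x s).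
Proof.
case: s => [|a [|b s]] //; case: x => //= /and3P[a_gt0 b_gt0 s_gt0].
  by rewrite push_two_cons2; case: ifP; rewrite /= ?a_gt0 ?b_gt0.
by rewrite b_gt0.
Qed.

Lemma sumn_push (x : bool) (s : seq nat) :
  1 < size s -> sumn (push x s) = sumn s + x.+1.
Proof.
case: s => [|a [|b s]] //= _; case: x; last by rewrite /= addn1.
by rewrite /= push_two_cons2; case: ifP => /=; lia.
Qed.

Lemma foldr_push_ones (d a b : nat) (s : seq nat) :
  foldr push [:: a, b & s] (nseq d false) = [:: d + a, b & s].
Proof. by elim: d => //= d ->. Qed.

Lemma foldr_push_ones_seq1 (d a : nat) :
  0 < d -> foldr push [:: a] (nseq d false) = [:: d + a; a].
Proof. by elim: d => //= -[//|d] ->. Qed.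

Lemma foldr_push_twos (b : nat) (s : seq nat) :
  0 < b -> s != [::] -> ~~ starts_tied s ->
  foldr push s (nseq b true) = [:: b, b & s].
Proof.
move=> + s_neq0 untied_s; elim: b => [//|[|b] IH _].
  by rewrite /= /push_two (negbTE untied_s).
by have /= -> := IH isT; rewrite push_two_cons2 s_neq0 eqxx.
Qed.

Definition arndt_of_word (m : nat) (w : bitseq) : seq nat :=
  foldr push [:: m] w.

Section ArndtOfWord.

Variable m : nat.
Implicit Type w : bitseq.

Lemma arndt_of_word_neq0 w : arndt_of_word m w != [::].
Proof.
elim: w => //= x w IH.
by rewrite -size_eq0 -lt0n (ltnW (size_push_gt1 x IH)).
Qed.

Lemma near_arndt_of_word w : near_arndt (arndt_of_word m w).
Proof.
elim: w => /= [|x w IH]; first by rewrite /near_arndt is_arndt_short.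
by rewrite near_arndt_push ?arndt_of_word_neq0.
Qed.

Lemma is_arndt_of_word w : is_arndt (arndt_of_word m w) = ~~ head false w.
Proof.
rewrite is_arndt_near near_arndt_of_word; case: w => //= x w.
by rewrite starts_tied_push ?arndt_of_word_neq0 ?near_arndt_of_word.
Qed.

Lemma last_arndt_of_word w : last 0 (arndt_of_word m w) = m.
Proof. by elim: w => //= x w IH; rewrite last_push ?arndt_of_word_neq0. Qed.

Lemma all_gt0_arndt_of_word w :
  0 < m -> all (fun a => 0 < a) (arndt_of_word m w).
Proof.
by move=> m_gt0; elim: w => /= [|x w IH]; rewrite ?m_gt0 ?all_gt0_push.
Qed.

Lemma sumn_arndt_of_word w :
  sumn (arndt_of_word m w) = weight w + (if last true w then m else 2 * m).
Proof.
elim: w => [|x [|y w] IH]; first by rewrite /= addn0.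
  by case: x; rewrite /weight /=; lia.
rewrite [LHS]sumn_push ?size_push_gt1 ?arndt_of_word_neq0 // IH /weight /=.
by lia.
Qed.

End ArndtOfWord.

Lemma arndt_of_wordK (m : nat) : cancel (arndt_of_word m) word_of_arndt.
Proof.
elim=> //= x w IH.
by rewrite word_of_arndt_push ?arndt_of_word_neq0 ?near_arndt_of_word // IH.
Qed.

Lemma word_of_arndtK (s : seq nat) :
  s != [::] -> all (fun a => 0 < a) s -> is_arndt s ->
  arndt_of_word (last 0 s) (word_of_arndt s) = s.
Proof.
have [k] := ubnP (size s); elim: k s => // k IH [|a [|b [|c s]]] //= lt_sk _.
  rewrite is_arndt_cons2 /arndt_of_word => _ /andP[lt_ba _].
  by rewrite cats0 foldr_push_ones_seq1 ?subn_gt0 // subnK // ltnW.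
rewrite is_arndt_cons2 => /and3P[_ b_gt0 s_gt0] /andP[lt_ba arndt_s].
have untied_s : ~~ starts_tied (c :: s).
  by move: arndt_s; rewrite is_arndt_near => /andP[].
have := IH (c :: s) (ltnW lt_sk) isT s_gt0 arndt_s.
rewrite /arndt_of_word !foldr_cat => /= ->.
by rewrite foldr_push_twos // foldr_push_ones subnK // ltnW.
Qed.

(* Without the guard the truncated [n - m] would admit the empty word for
   [n < m]; the truncated [n - 2 * m] is harmless, as that word satisfies
   [last true]. *)
Definition arndt_words (n m : nat) : seq bitseq :=
  if m <= n then
    [seq w <- words (n - m) | ~~ head false w & last true w] ++
    [seq w <- words (n - 2 * m) | ~~ head false w & ~~ last true w]
  else [::].

Lemma mem_arndt_words (n m : nat) (w : bitseq) :
  (w \in arndt_words n m) =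
  ~~ head false w && (weight w + (if last true w then m else 2 * m) == n).
Proof.
rewrite /arndt_words; case: leqP => le_mn; last first.
  by rewrite in_nil; case: ifP; lia.
rewrite mem_cat !mem_filter !mem_words.
by case: w => [|x w]; rewrite /weight /=; [lia | case: ifP; lia].
Qed.

Lemma uniq_arndt_words (n m : nat) : uniq (arndt_words n m).
Proof.
rewrite /arndt_words; case: ifP => // _.
rewrite cat_uniq !filter_uniq ?uniq_words // andbT.
by apply/hasPn => w; rewrite !mem_filter; case: (last true w); rewrite ?andbF.
Qed.

Lemma size_arndt_words (n m : nat) :
  size (arndt_words n m) = if m <= n then t1 (n - m) + t2 (n - 2 * m) else 0.
Proof.
rewrite /arndt_words; case: ifP => // _.
by rewrite size_cat !size_filter count_words_t1 count_words_t2.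
Qed.

Lemma mem_map_arndt_of_word (n m : nat) (s : seq nat) : 0 < m ->
  (s \in map (arndt_of_word m) (arndt_words n m)) = is_arndt_last n m s.
Proof.
move=> m_gt0; apply/mapP/idP => [[w + ->]|].
  rewrite mem_arndt_words /is_arndt_last /is_composition.
  rewrite all_gt0_arndt_of_word // sumn_arndt_of_word is_arndt_of_word.
  by rewrite last_arndt_of_word eqxx andbT andbC.
case/and3P=> /andP[s_gt0 /eqP sum_s] arndt_s /eqP last_s.
have s_neq0 : s != [::] by apply: contraTneq m_gt0 => s0; rewrite -last_s s0.
have sK := word_of_arndtK s_neq0 s_gt0 arndt_s; rewrite last_s in sK.
exists (word_of_arndt s) => //; rewrite mem_arndt_words -sumn_arndt_of_word.
by rewrite -(is_arndt_of_word m) sK arndt_s sum_s eqxx.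
Qed.

Lemma b_arndt_words (n m : nat) : 0 < m -> b n m = size (arndt_words n m).
Proof.
move=> m_gt0; rewrite -(size_map (arndt_of_word m)).
apply: b_enum => [|s]; last exact: mem_map_arndt_of_word.
rewrite map_inj_uniq ?uniq_arndt_words //.
exact: can_inj (@arndt_of_wordK m).
Qed.

Theorem theorem3p2 (n m : nat) (hn : 1 <= n) (hm : 1 <= m) :
  b n m = if m <= n < 2 * m then t1 (n - m)
          else if 2 * m <= n then t1 (n - m) + t2 (n - 2 * m)
          else 0.
Proof.
rewrite b_arndt_words // size_arndt_words.
have [le_mn|lt_nm] := leqP m n; have [le_2mn|lt_n2m] := leqP (2 * m) n => //=.
  by rewrite (eqP (ltnW lt_n2m)) addn0.
by lia.
Qed.
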